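(* Let $a\le x<x'\le b$ be real numbers, $0<\alpha\le\frac12$, $y=(1-\alpha)x+\alpha x'$, $y'=\alpha x+(1-\alpha)x'$, and let $f:[a,b]\to\mathbb{R}$ be convex. Let $G_1,Q_1:[0,1]\to\mathbb{R}$ be the functions defined in the context. Then: (1) $Q_1$ is symmetric about $\frac12$, decreasing on $[0,\frac12]$ and increasing on $[\frac12,1]$. (2) The following inequalities hold: $$G_1\left(\frac t\alpha\right)\le Q_1(t)\quad\left(t\in\left[0,\frac\alpha2\right]\right),\qquad G_1\left(\frac t\alpha\right)\ge Q_1(t)\quad\left(t\in\left[\frac\alpha2,\alpha\right]\right),$$ $$G_1\left(\frac{1-t}\alpha\right)\ge Q_1(t)\quad\left(t\in\left[1-\alpha,1-\frac\alpha2\right]\right),\qquad G_1\left(\frac{1-t}\alpha\right)\le Q_1(t)\quad\left(t\in\left[1-\frac\alpha2,1\right]\right).$$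
   Context: A function $F$ on $[0,1]$ is symmetric about $\frac12$ if $F(t)=F(1-t)$. Monotonicity is meant in the weak (non-strict) sense. For $t\in[0,1]$ define $$G_1(t)=\frac12\left[f(tx+(1-t)y)+f(tx'+(1-t)y')\right],\qquad Q_1(t)=\frac12\left[f(tx+(1-t)x')+f(tx'+(1-t)x)\right].$$ *)

(* Defs.v *)
From HB Require Import structures.
From mathcomp Require Export all_boot all_order all_algebra.
From mathcomp Require Export classical_sets reals set_interval interval_inference
  numfun convex.

Set Implicit Arguments.
Unset Strict Implicit.
Unset Printing Implicit Defensive.

Import Order.TTheory GRing.Theory Num.Theory.
Local Open Scope ring_scope.

Definition symmetric_about_half (R : realType) (F : R -> R) : Prop :=
  {in `[0, 1], forall t, F t = F (1 - t)}.

(* A function on a real interval is represented by a total function R -> R, and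
   only its values on that interval are meaningful: [a, b] for f, and [0, 1]
   for G1 and Q1. *)
Definition G1 (R : realType) (f : R -> R) (x x' y y' : R) (t : R) : R :=
  2^-1 * (f (t * x + (1 - t) * y) + f (t * x' + (1 - t) * y')).

Definition Q1 (R : realType) (f : R -> R) (x x' : R) (t : R) : R :=
  2^-1 * (f (t * x + (1 - t) * x') + f (t * x' + (1 - t) * x)).

(* Main.v *)
(* A convex f satisfies f p + f q <= f u + f v whenever p + q = u + v and
   u <= p <= v; hence Q1 is nonincreasing on [0, 1/2], and by its symmetry
   nondecreasing on [1/2, 1].  Moreover G1 (t / alpha) = Q1 (alpha - t), since
   the sample points of both are x + (alpha - t) (x' - x) and
   x' - (alpha - t) (x' - x), so each comparison of G1 with Q1 is an instance
   of the monotonicity of Q1. *)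
Require Import Defs.
From mathcomp Require Import all_boot all_order all_algebra.
From mathcomp Require Import classical_sets reals set_interval interval_inference
  numfun convex.
From mathcomp Require Import ring lra.

Set Implicit Arguments.
Unset Strict Implicit.
Unset Printing Implicit Defensive.

Import Order.TTheory GRing.Theory Num.Theory.
Local Open Scope ring_scope.

(** Unfolds abstract convex combinations with a bundled weight into plain real arithmetic, the form
    that [nra] can use. *)
Lemma convex_function_le (R : realType) (a b : R) (f : R -> R) :
  convex_function (E := R^o) `[a, b]%classic f ->
  forall u v l : R, u \in `[a, b] -> v \in `[a, b] -> 0 <= l <= 1 ->
  f (l * u + (1 - l) * v) <= l * f u + (1 - l) * f v.
Proof.
move=> hf u v l hu hv /andP[l0 l1].
have := hf (Itv01 l0 l1) u v; rewrite !inE => /(_ hu hv).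
by rewrite !convRE.
Qed.

(** Since [p + q = u + v], the points [p] and [q] are combinations of [u] and [v] with swapped
    weights; adding the two convexity bounds gives [f u] and [f v] total weight 1 each. *)
Lemma convex_sum_le (R : realType) (a b : R) (f : R -> R) :
  convex_function (E := R^o) `[a, b]%classic f ->
  forall u v p q : R, a <= u -> v <= b -> u <= p <= v -> p + q = u + v ->
  f p + f q <= f u + f v.
Proof.
move=> hf u v p q au vb /andP[up pv] pq.
(* The weight [l] below divides by [v - u], so the degenerate interval is treated apart. *)
have [uv|uv] := eqVneq u v.
  have -> : p = u by lra.
  by have -> : q = v by lra.
have d0 : 0 < v - u by rewrite subr_gt0 lt_neqAle uv (le_trans up pv).
have dN0 := lt0r_neq0 d0.
pose l := (v - p) / (v - u).
have hl : 0 <= l <= 1 by rewrite divr_ge0 ?ler_pdivrMr //=; lra.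
have hl' : 0 <= 1 - l <= 1 by lra.
have hu : u \in `[a, b] by rewrite in_itv /=; lra.
have hv : v \in `[a, b] by rewrite in_itv /=; lra.
have pE : p = l * u + (1 - l) * v by rewrite /l; field.
have qE : q = (1 - l) * u + (1 - (1 - l)) * v.
  have -> : q = u + v - p by lra.
  by rewrite {1}pE; ring.
have := convex_function_le hf hu hv hl; have := convex_function_le hf hu hv hl'.
rewrite -pE -qE; nra.
Qed.

Lemma Q1_symmetric (R : realType) (f : R -> R) (x x' t : R) :
  Q1 f x x' (1 - t) = Q1 f x x' t.
Proof. by rewrite /Q1 subKr addrC [_ * x' + _]addrC [_ * x + _]addrC addrC. Qed.

Lemma Q1_nonincreasing (R : realType) (a b x x' : R) (f : R -> R) :
  convex_function (E := R^o) `[a, b]%classic f -> a <= x -> x <= x' -> x' <= b ->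
  forall s t : R, 0 <= s -> s <= t -> t <= 2^-1 -> Q1 f x x' t <= Q1 f x x' s.
Proof.
move=> hf ax xx' x'b s t s0 st t2.
(* The swaps put the left sample point first: [u = x + s (x' - x)] and [p = x + t (x' - x)]. Both
   pairs sum to [x + x'], and [v - p = (1 - s - t) (x' - x)] is nonnegative as [s, t <= 1/2]. *)
rewrite /Q1 ler_wpM2l ?invr_ge0 // [leLHS]addrC [leRHS]addrC.
by apply: (convex_sum_le hf); [nra | nra | nra | ring].
Qed.

Lemma G1_Q1 (R : realType) (f : R -> R) (x x' alpha t : R) : alpha != 0 ->
  G1 f x x' ((1 - alpha) * x + alpha * x') (alpha * x + (1 - alpha) * x')
    (t / alpha) = Q1 f x x' (alpha - t).
Proof.
move=> alpha0; rewrite /G1 /Q1 [in RHS]addrC.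
by congr (_ * (f _ + f _)); field.
Qed.

Theorem theorem20 (R : realType) (a b x x' alpha y y' : R) (f : R -> R)
    (hax : a <= x) (hxx' : x < x') (hx'b : x' <= b)
    (halpha0 : 0 < alpha) (halpha : alpha <= 2^-1)
    (hy : y = (1 - alpha) * x + alpha * x')
    (hy' : y' = alpha * x + (1 - alpha) * x')
    (hf : convex_function (E := R^o) `[a, b]%classic f) :
  [/\ symmetric_about_half (Q1 f x x'),
      {in `[0, 2^-1] &, nonincreasing_fun (Q1 f x x')}
    & {in `[2^-1, 1] &, nondecreasing_fun (Q1 f x x')}]
  /\
  [/\ {in `[0, alpha / 2], forall t,
         G1 f x x' y y' (t / alpha) <= Q1 f x x' t},
      {in `[alpha / 2, alpha], forall t,
         G1 f x x' y y' (t / alpha) >= Q1 f x x' t},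
      {in `[1 - alpha, 1 - alpha / 2], forall t,
         G1 f x x' y y' ((1 - t) / alpha) >= Q1 f x x' t}
    & {in `[1 - alpha / 2, 1], forall t,
         G1 f x x' y y' ((1 - t) / alpha) <= Q1 f x x' t}].
Proof.
have a0 : alpha != 0 by rewrite gt_eqF.
have mono := Q1_nonincreasing hf hax (ltW hxx') hx'b.
rewrite {}hy {}hy'; split; split.
- by move=> t _; rewrite Q1_symmetric.
- by move=> s t; rewrite !in_itv /= => hs ht st; apply: mono; lra.
- move=> s t; rewrite !in_itv /= => hs ht st.
  (* Reflection sends [s <= t] in [[1/2, 1]] to [1 - t <= 1 - s] in [[0, 1/2]]. *)
  by rewrite -Q1_symmetric -[leRHS]Q1_symmetric; apply: mono; lra.
(* Here [t <= alpha - t <= 1/2]; in the next case [alpha - t <= t <= alpha <= 1/2]. *)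
- by move=> t; rewrite in_itv /= G1_Q1 // => ht; apply: mono; lra.
- by move=> t; rewrite in_itv /= G1_Q1 // => ht; apply: mono; lra.
(* Reflecting [Q1] turns the last two cases into the previous two with [1 - t] in place of [t], in
   reverse order. *)
- move=> t; rewrite in_itv /= G1_Q1 // -(Q1_symmetric _ _ _ t) => ht.
  by apply: mono; lra.
- move=> t; rewrite in_itv /= G1_Q1 // -(Q1_symmetric _ _ _ t) => ht.
  by apply: mono; lra.
Qed.
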